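(* Let $n,q\in\mathbb{N}$ with $q>n$. Let $X$ be a normal space of dimension $n$. Let $Y$ be a metric topological manifold. Let $Z$ be a subset of $Y$ of Lipschitz codimension at least $q$ in $Y$. Then $Z$ is $X$-avoidable.
   Context: $\mathbb{N}=\{0,1,2,\ldots\}$. A topological space is normal if any two disjoint closed subsets have disjoint neighborhoods. Dimension means Lebesgue covering dimension. A refinement of an open covering $(U_i)_{i\in I}$ of $X$ is an open covering $(V_j)_{j\in J}$ of $X$ such that for all $j\in J$ there exists $i\in I$ with $V_j\subset U_i$. For $d\in\mathbb{N}$, $X$ has dimension at most $d$ if any open covering of $X$ has a refinement $(V_j)_{j\in J}$ such that for all $x\in X$ the set $\{j\in J : x\in V_j\}$ has at most $d+1$ elements. The dimension of $X$ is the smallest such $d$ (or $\infty$ if none exists). A manifold of dimension $p\in\mathbb{N}$ is a Hausdorff space where every point has a neighborhood homeomorphic to $\mathbb{R}^p$. A metric topological manifold is a metric space whose underlying topological space is a manifold. Lipschitz codimension: let $p,q\in\mathbb{N}$, let $Y$ be a metric topological manifold of dimension $p$ and let $Z\subset Y$. One says that $Z$ has Lipschitz codimension at least $q$ in $Y$ if there exist an open covering $(U_i)_{i\in I}$ of $Y$ and, for all $i\in I$, a homeomorphism $\phi_i$ from $U_i$ to an open subset of $\mathbb{R}^p$, such that for all $i\in I$: (1) $\phi_i^{-1}$ is Lipschitz (with respect to the Euclidean metric on $\phi_i(U_i)$ and the metric of $Y$); (2) $\phi_i(U_i\cap Z)$ is a subset of $\mathbb{R}^{p-q}$, seen as the vector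 subspace of $\mathbb{R}^p$ consisting of vectors ending with $q$ zeros. Avoidability: let $X$ be a topological space, $Y$ a metric space with metric $d$, and $Z\subset Y$. One says that $Z$ is $X$-avoidable (in $Y$) if for any continuous map $f:X\to Y$ and any continuous function $\varepsilon:X\to\mathbb{R}_{>0}$ there exists a continuous map $g:X\to Y$ such that for all $x\in X$, $g(x)\notin Z$ and $d(f(x),g(x))<\varepsilon(x)$. *)

(* Defs.v *)
From mathcomp Require Import all_boot all_order all_algebra.
From mathcomp Require Import all_classical all_reals all_analysis.

Set Implicit Arguments.
Unset Strict Implicit.
Unset Printing Implicit Defensive.

Import Order.TTheory GRing.Theory Num.Theory.
Import numFieldNormedType.Exports.

Local Open Scope classical_set_scope.
Local Open Scope ring_scope.

Definition open_covering (X : topologicalType) (I : Type) (U : I -> set X) :=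
  (forall i, open (U i)) /\ \bigcup_i U i = setT.

Definition refines (X I J : Type) (V : J -> set X) (U : I -> set X) :=
  forall j, exists i, V j `<=` U i.

(* Lebesgue covering dimension. Members of a covering are counted by index. *)
Definition dim_at_most (X : topologicalType) (d : nat) :=
  forall (I : Type) (U : I -> set X), open_covering U ->
    exists (J : Type) (V : J -> set X),
      [/\ open_covering V, refines V U &
          forall x, ([set j | V j x] #<= `I_d.+1)%card].

(* In particular [has_dimension X n] says that the dimension is finite. *)
Definition has_dimension (X : topologicalType) (n : nat) :=
  dim_at_most X n /\ forall d : nat, dim_at_most X d -> (n <= d)%N.

(* f restricts to a homeomorphism from A to B, with inverse the restriction of
   g; the values of f outside A and of g outside B are irrelevant. *)
Definition homeomorphism_between (S T : topologicalType)
    (A : set S) (B : set T) (f : S -> T) (g : T -> S) :=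
  [/\ set_fun A B f, set_fun B A g,
      (forall x, A x -> g (f x) = x), (forall y, B y -> f (g y) = y) &
      {within A, continuous f} /\ {within B, continuous g}].

(* The topology on ['rV[R]_p] is the product topology. *)
Definition is_manifold (R : realType) (p : nat) (M : topologicalType) :=
  hausdorff_space M /\
  forall x : M, exists2 N : set M, nbhs x N &
    exists (f : M -> 'rV[R]_p) (g : 'rV[R]_p -> M),
      homeomorphism_between N setT f g.

(* The library norm on ['rV[R]_p] is the sup norm, not the Euclidean one. *)
Definition euclidean_dist (R : realType) (p : nat) (v w : 'rV[R]_p) : R :=
  Num.sqrt (\sum_(i < p) (v ord0 i - w ord0 i) ^+ 2).

(* R^(p - q) inside R^p: the vectors ending with q zeros. There are none when
   q > p, hence the first conjunct (the subtraction below is truncated). *)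
Definition ends_with_zeros (R : realType) (p q : nat) : set 'rV[R]_p :=
  [set v : 'rV[R]_p |
    (q <= p)%N /\ forall i : 'I_p, (p - q <= i)%N -> v ord0 i = 0].

(* Z has Lipschitz codimension at least q in the p-dimensional manifold Y;
   psi i is the inverse of the chart phi i. *)
Definition lipschitz_codim_at_least (R : realType) (p q : nat)
    (Y : metricType R) (Z : set Y) :=
  exists (I : Type) (U : I -> set Y) (V : I -> set 'rV[R]_p)
         (phi : I -> Y -> 'rV[R]_p) (psi : I -> 'rV[R]_p -> Y),
    open_covering U /\
    forall i,
      [/\ open (V i),
          homeomorphism_between (U i) (V i) (phi i) (psi i),
          (exists k : R, forall v w, V i v -> V i w ->
             mdist (psi i v) (psi i w) <= k * euclidean_dist v w) &
          phi i @` (U i `&` Z) `<=` ends_with_zeros q].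

Definition avoidable (R : realType) (X : topologicalType) (Y : metricType R)
    (Z : set Y) :=
  forall (f : X -> Y) (eps : X -> R),
    continuous f -> continuous eps -> (forall x, 0 < eps x) ->
    exists2 g : X -> Y, continuous g &
      forall x, ~ Z (g x) /\ mdist (f x) (g x) < eps x.

(* Main.v *)
Require Import Defs.
From mathcomp Require Import all_boot all_order all_algebra.
From mathcomp Require Import all_classical all_reals all_analysis.
From mathcomp Require wochoice.
From mathcomp Require Import lra.

(* Locally, in a chart, one has to push a map into R^q off the origin; since
   dim X < q this is possible by the theorem on partitions: a map K from X to the
   cube [-1, 1]^q can be replaced by a nowhere vanishing map L that agrees
   coordinatewise with K wherever a coordinate of K is 1 or -1. A normal space need
   not be paracompact, so the local modifications are organized in Y: by Stone's
   construction the metric space Y is covered by countably many families of sets,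
   the m-th family being uniformly separated and subordinate to the charts. Stage m
   modifies the map simultaneously over the m-th family, and only at points not
   settled by an earlier stage; thus the sequence of maps is locally eventually
   constant and its limit avoids Z. The closure of Z has the same Lipschitz
   codimension, so Z may be assumed closed, and later small modifications do not
   run into Z again. *)

Set Implicit Arguments.
Unset Strict Implicit.
Unset Printing Implicit Defensive.

Import Order.TTheory GRing.Theory Num.Theory.
Import numFieldNormedType.Exports.

Local Open Scope classical_set_scope.
Local Open Scope ring_scope.

(** * Continuity of maxima, minima and clamping *)

Lemma cvg_maxr (R : realType) (T : Type) (F : set_system T) (FF : Filter F)
    (f g : T -> R) (a b : R) :
  f @ F --> a -> g @ F --> b -> Num.max (f x) (g x) @[x --> F] --> Num.max a b.
Proof.
move=> fa gb.
exact: (cvg_comp _ _ (cvg_pair fa gb) (@max_continuous _ R (a, b))).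
Qed.

Lemma cvg_minr (R : realType) (T : Type) (F : set_system T) (FF : Filter F)
    (f g : T -> R) (a b : R) :
  f @ F --> a -> g @ F --> b -> Num.min (f x) (g x) @[x --> F] --> Num.min a b.
Proof.
move=> fa gb.
exact: (cvg_comp _ _ (cvg_pair fa gb) (@min_continuous _ R (a, b))).
Qed.

Definition clamp (R : realType) (a : R) : R := Num.max (-1) (Num.min 1 a).

Lemma cvg_clamp (R : realType) (T : Type) (F : set_system T) (FF : Filter F)
    (f : T -> R) (a : R) :
  f @ F --> a -> clamp (f x) @[x --> F] --> clamp a.
Proof.
by move=> fa; apply: cvg_maxr; [exact: cvg_cst | apply: cvg_minr => //; exact: cvg_cst].
Qed.

Lemma clampP (R : realType) (a : R) :
  [\/ a <= -1 /\ clamp a = -1, 1 <= a /\ clamp a = 1 |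
      -1 < a < 1 /\ clamp a = a].
Proof.
rewrite /clamp; case: (leP a (-1)) => a1.
  by apply: Or31; split=> //; rewrite min_r ?max_l//; lra.
case: (leP 1 a) => a2.
  by apply: Or32; split=> //; rewrite max_r//; lra.
by apply: Or33; split; [lra | rewrite max_r//; lra].
Qed.

Lemma clamp_itv (R : realType) (a : R) : -1 <= clamp a <= 1.
Proof. by case: (clampP a) => -[? ->]; lra. Qed.

Lemma clamp_eq0 (R : realType) (a : R) : clamp a = 0 -> a = 0.
Proof. by case: (clampP a) => -[? ->]; lra. Qed.

Lemma continuous_bigmax (R : realType) (X : topologicalType) (I : Type)
    (r : seq I) (P : pred I) (w : I -> X -> R) :
  (forall i, continuous (w i)) ->
  continuous (fun x => \big[Num.max/0]_(i <- r | P i) w i x).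
Proof.
move=> cw; elim: r => [|i r IH].
  rewrite (_ : (fun x => _) = cst 0); first by move=> x; exact: cvg_cst.
  by apply/funext => x; rewrite big_nil.
rewrite (_ : (fun x => _) = fun x => if P i
    then Num.max (w i x) (\big[Num.max/0]_(j <- r | P j) w j x)
    else \big[Num.max/0]_(j <- r | P j) w j x); last first.
  by apply/funext => x; rewrite big_cons.
by case: (P i) => // x; apply: cvg_maxr; [exact: cw | exact: IH].
Qed.

Lemma bigmax_attained (R : realType) (I : Type) (r : seq I) (P : pred I)
    (w : I -> R) :
  0 < \big[Num.max/0]_(i <- r | P i) w i ->
  exists2 i, P i & \big[Num.max/0]_(i <- r | P i) w i = w i.
Proof.
elim: r => [|i r IH]; first by rewrite big_nil ltxx.
rewrite big_cons; case: ifP => Pi //.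
by rewrite maxEle; case: ifP => // _ _; exists i.
Qed.

(** * Finite covers of normal spaces and the theorem on partitions *)

Lemma urysohn_function (R : realType) (X : topologicalType) (A B : set X) :
  normal_space X -> closed A -> closed B -> (forall x, A x -> ~ B x) ->
  exists h : X -> R, [/\ continuous h, (forall x, 0 <= h x <= 1),
    (forall x, A x -> h x = 0) & (forall x, B x -> h x = 1)].
Proof.
move=> /(@normal_separatorP R) sepX cA cB AB.
have AB0 : A `&` B = set0.
  by rewrite -subset0 => x [Ax Bx]; exact: AB Bx.
have /(@uniform_separatorP _ R) [h [ch h01 hA hB]] := sepX _ _ cA cB AB0.
exists h; split=> // [x|x Ax|x Bx].
- by have := h01 (h x); rewrite /= in_itv/=; apply; exists x.
- by apply: hA; exists x.
- by apply: hB; exists x.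
Qed.

(** A substitute for a partition of unity, normalized to have maximum 1 because level sets are used
    later. Members are shrunk one at a time by Urysohn functions; at each step the sets [2^-1 < w t]
    for treated indices and [V t] for the others cover [X]. *)
Lemma finite_cover_functions (R : realType) (X : topologicalType)
    (T : finType) (V : T -> set X) :
  normal_space X -> (forall t, open (V t)) -> (forall x, exists t, V t x) ->
  exists w : T -> X -> R, [/\ (forall t, continuous (w t)),
    (forall t x, 0 <= w t x), (forall t x, w t x != 0 -> V t x) &
    forall x, (exists t, w t x = 1) /\ forall t, w t x <= 1].
Proof.
move=> nX oV cV.
suff [w [cw w0 wV w1]] : exists w : T -> X -> R, [/\ (forall t, continuous (w t)),
    (forall t x, 0 <= w t x), (forall t x, w t x != 0 -> V t x) &
    forall x, exists2 t, t \in enum T & 2^-1 < w t x].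
  exists (fun t x => Num.min 1 (2 * w t x)); split.
  - move=> t x; apply: cvg_minr; first exact: cvg_cst.
    by apply: cvgMr => //; exact: cw.
  - by move=> t x; rewrite le_min ler01 mulr_ge0.
  - move=> t x; case: (eqVneq (w t x) 0) => [->|? _]; last exact: wV.
    by rewrite mulr0 min_r ?eqxx.
  - move=> x; split=> [|t]; last by rewrite ge_min lexx.
    by have [t _ wt] := w1 x; exists t; rewrite min_l//; lra.
suff [w [cw w0 wV w1]] : exists w : T -> X -> R, [/\ (forall t, continuous (w t)),
    (forall t x, 0 <= w t x), (forall t x, w t x != 0 -> V t x) &
    forall x, (exists2 t, t \in enum T & 2^-1 < w t x) \/
              (exists2 t, t \notin enum T & V t x)].
  exists w; split=> // x; case: (w1 x) => // -[t].
  by rewrite mem_enum.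
elim: (enum T) => [|t r [w [cw w0 wV w1]]].
  exists (fun _ _ => 0); split=> //.
  - by move=> t x; exact: cvg_cst.
  - by move=> t x; rewrite eqxx.
  - by move=> x; right; have [t] := cV x; exists t.
case: (boolP (t \in r)) => tr.
  exists w; split=> // x; case: (w1 x) => -[s sr ws].
    by left; exists s => //; rewrite inE sr orbT.
  right; exists s => //; rewrite inE negb_or sr andbT.
  by apply: contraNneq sr => ->.
(* [O] is what is covered without [V t]; its complement is a closed set inside [V t], on which [h]
   will be 1. *)
pose O : set X := (\bigcup_(s in [set s | s \in r]) (w s @^-1` [set y | 2^-1 < y]))
  `|` \bigcup_(s in [set s | s \notin t :: r]) V s.
have oO : open O.
  apply: openU; apply: bigcup_open => s _ //.
  by apply: open_comp; [move=> y _; exact: cw | exact: open_gt].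
have [h [ch h01 h0 h1]] : exists h : X -> R, [/\ continuous h,
    (forall x, 0 <= h x <= 1),
    (forall x, (~` V t) x -> h x = 0) & (forall x, (~` O) x -> h x = 1)].
  apply: urysohn_function => //; rewrite ?closedC// => x nVx nOx.
  case: (w1 x) => -[s sr ws].
    by apply: nOx; left; exists s.
  apply: nOx; right; exists s => //=; rewrite inE negb_or sr andbT.
  by apply/eqP => st; apply: nVx; rewrite -st.
exists (fun s => if s == t then h else w s); split.
- by move=> s; case: eqP.
- by move=> s x; case: eqP => // _; case/andP: (h01 x).
- move=> s x; case: (eqVneq s t) => [->|_]; last exact: wV.
  by move=> hx; apply: contrapT => nV; rewrite h0 ?eqxx in hx.
- move=> x; case: (pselect (O x)) => [[|] [s /= sr ws]|/h1 hx].
  + left; exists s; first by rewrite inE sr orbT.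
    by case: eqP => // st; rewrite -st sr in tr.
  + by right; exists s.
  + left; exists t; first by rewrite inE eqxx.
    by rewrite eqxx hx; lra.
Qed.

(** Members of a refinement are grouped by a chosen member of the original cover containing them.
    Distinct groups through [x] come from distinct members through [x], so grouping does not raise
    the order. *)
Lemma finite_cover_refinement (X : topologicalType) (n : nat) (T : finType)
    (O : T -> set X) :
  dim_at_most X n -> (forall t, open (O t)) -> (forall x, exists t, O t x) ->
  exists V : T -> set X, [/\ (forall t, open (V t)), (forall t, V t `<=` O t),
    (forall x, exists t, V t x) &
    forall x (A : {set T}), (forall t, t \in A -> V t x) -> (#|A| <= n.+1)%N].
Proof.
move=> dimX oO cO.
have [|J [W [[oW cW] rW ordW]]] := dimX T O.
  by split=> //; rewrite -subTset => x _; have [t] := cO x; exists t.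
have [c cP] := choice rW.
exists (fun t => \bigcup_(j in [set j | c j = t]) W j); split.
- by move=> t; apply: bigcup_open => j _; exact: oW.
- by move=> t x [j /= <-]; exact: cP.
- move=> x; have : (\bigcup_i W i) x by rewrite cW.
  by move=> [j _ Wj]; exists (c j), j.
move=> x A VA.
have /choice[b bP] : forall t, exists j, t \in A -> c j = t /\ W j x.
  move=> t; case: (boolP (t \in A)) => [tA|_].
    by have [j /= cj Wj] := VA t tA; exists j.
  have : (\bigcup_i W i) x by rewrite cW.
  by move=> [j _ _]; exists j.
have /pcard_leP[g] := ordW x.
have gI t : t \in A -> (g (b t) < n.+1)%N.
  by move=> tA; have [_] := bP t tA; exact: (@funS _ _ _ _ g).
rewrite -[n.+1]card_ord.
apply: (@leq_card_in _ _ (fun t => inord (g (b t)) : 'I_n.+1)) => t s tA sA.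
move=> /(congr1 val) /=; rewrite !inordK ?gI// => gts.
have [ct Wt] := bP t tA; have [cs Ws] := bP s sA.
rewrite -ct -cs; congr c.
by apply: (@inj _ _ _ g); [exact/mem_set | exact/mem_set |].
Qed.

(* The theorem on partitions: nested level sets of the functions [w s] play the
   role of the partitions, with a different level for each coordinate, so that a
   common zero would lie in more than [n + 1] members of the cover. *)
Lemma avoid_zero_rel (R : realType) (X : topologicalType) (n p : nat)
    (P : {set 'I_p}) (K : 'I_p -> X -> R) :
  normal_space X -> dim_at_most X n -> (n < #|P|)%N ->
  (forall j, continuous (K j)) ->
  exists L : 'I_p -> X -> R, [/\ (forall j, continuous (L j)),
    (forall j x, -1 <= L j x <= 1),
    (forall j x, K j x = 1 \/ K j x = -1 -> L j x = K j x) &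
    forall x, exists2 j, j \in P & L j x != 0].
Proof.
move=> nX dX nP cK.
pose side b : R := if b then 1 else -1.
(* The bit [s j] tells which of the faces [K j = 1] and [K j = -1] the set [O s] avoids. *)
pose O (s : {ffun 'I_p -> bool}) : set X :=
  [set x | forall j, K j x != side (s j)].
have [||V [oV VO cV ordV]] := @finite_cover_refinement X n _ O dX.
- move=> s; rewrite openE => x Ox; apply: filter_forall => j.
  suff : nbhs x (K j @^-1` (~` [set side (s j)])) by apply: filterS => y /eqP.
  apply: open_nbhs_nbhs; split; last by move/eqP: (Ox j).
  apply: open_comp => //; rewrite openC; exact: closed_eq.
- move=> x; exists [ffun j => K j x != 1] => j; rewrite ffunE /side.
  by case: (eqVneq (K j x) 1) => //= ->; apply/eqP; lra.
have [w [cw w0 wV w1]] := finite_cover_functions R nX oV cV.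
(* The levels are distinct and at distance at least [1 / (p + 1)] from 0 and 1, so the factor
   [p + 1] below brings [L j] to -1 or 1 when [M j] is 0 or 1. *)
pose c (j : 'I_p) : R := j.+1%:R / p.+1%:R.
have c0 j : p.+1%:R^-1 <= c j.
  by rewrite /c ler_peMl ?invr_ge0// ler1n.
have c1 j : c j <= 1 - p.+1%:R^-1.
  rewrite lerBrDr /c -[X in _ + X]mul1r -mulrDl ler_pdivrMr ?ltr0n// mul1r.
  by rewrite natr1 ler_nat ltnS.
(* Only members avoiding the face [K j = -1] enter, so [M j] is 1 on the face [K j = 1] and 0 on the
   opposite one. *)
pose M j x := \big[Num.max/0]_(s : {ffun 'I_p -> bool} | ~~ s j) w s x.
have M1 j x : M j x <= 1.
  by apply: bigmax_le => // s _; have [_] := w1 x.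
exists (fun j x => clamp (p.+1%:R * (M j x - c j))); split.
- move=> j x; apply: cvg_clamp; apply: cvgMr.
  by apply: cvgB; [exact: continuous_bigmax | exact: cvg_cst].
- by move=> j x; exact: clamp_itv.
- have p0 : (0 : R) < p.+1%:R by rewrite ltr0n.
  have pV : p.+1%:R * p.+1%:R^-1 = 1 :> R by rewrite divff// gt_eqF.
  move=> j x [] Kx; rewrite Kx.
    have -> : M j x = 1.
      apply/eqP; rewrite eq_le M1/=.
      have [[s ws] _] := w1 x; rewrite -ws; apply: bigmax_sup => //.
      apply/negP => sj.
      have /VO/(_ j) : V s x by apply: wV; rewrite ws oner_eq0.
      by rewrite /= sj Kx eqxx.
    have : p.+1%:R * p.+1%:R^-1 <= p.+1%:R * (1 - c j).
      by rewrite ler_pM2l// lerBrDr addrC -lerBrDr.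
    by rewrite pV => ge1; case: (clampP (p.+1%:R * (1 - c j))) => -[? ->] //; lra.
  have -> : M j x = 0.
    apply/eqP; rewrite eq_le; apply/andP; split; last exact: bigmax_ge_id.
    apply: bigmax_le => // s sj; rewrite leNgt; apply/negP => ws.
    have /VO/(_ j) : V s x by apply: wV; rewrite gt_eqF.
    by rewrite /= (negbTE sj) Kx eqxx.
  have : p.+1%:R * p.+1%:R^-1 <= p.+1%:R * c j by rewrite ler_pM2l.
  by rewrite pV sub0r mulrN => ge1; case: (clampP (- (p.+1%:R * c j))) => -[? ->] //; lra.
move=> x; apply: contrapT => noj.
have Mc j : j \in P -> M j x = c j.
  move=> jP; apply/eqP; rewrite -subr_eq0; apply/negPn/negP => Mj.
  apply: noj; exists j => //; apply: contra_neq Mj => /clamp_eq0/eqP.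
  by rewrite mulf_eq0 pnatr_eq0/= => /eqP.
have /choice[k kP] : forall j, exists s, j \in P -> w s x = c j.
  move=> j; case: (boolP (j \in P)) => jP; last by exists [ffun=> true].
  have [|s _ ws] := @bigmax_attained R _ (index_enum _) (fun s : {ffun 'I_p -> bool} => ~~ s j) (w^~ x).
    by rewrite -/(M j x) Mc//; apply: lt_le_trans (c0 j); rewrite invr_gt0 ltr0n.
  by exists s => _; rewrite -ws -Mc.
(* The members [k j] are distinct because the levels are, and [s0] differs from them as every level
   is below 1. This gives [#|P| + 1 > n + 1] members at [x]. *)
have [[s0 ws0] _] := w1 x.
have c_neq j : c j != 1.
  by rewrite lt_eqF//; apply: le_lt_trans (c1 j) _; rewrite gtrBl invr_gt0 ltr0n.
have c_gt0 j : 0 < c j by apply: lt_le_trans (c0 j); rewrite invr_gt0 ltr0n.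
have kI : {in P &, injective k}.
  move=> i j iP jP kij; apply/val_inj/eqP; have := kP i iP; rewrite kij kP//.
  move=> /(mulIf _) cij; rewrite -eqSS -(eqr_nat R); apply/eqP/esym/cij.
  by rewrite invr_neq0// pnatr_eq0.
have := ordV x (s0 |: k @: P); rewrite cardsU1 (card_in_imset kI).
have -> : s0 \notin k @: P.
  apply/imsetP => -[j jP s0k]; have := kP j jP; rewrite -s0k ws0 => /esym/eqP.
  exact/negP.
rewrite add1n ltnS leqNgt nP => /(_ _)/notF; apply => t.
rewrite !inE => /orP[/eqP ->|/imsetP[j jP ->]]; apply: wV.
  by rewrite ws0 oner_eq0.
by rewrite kP// gt_eqF.
Qed.

(* The distance from [y] to [A], capped at 1 so that the infimum is taken over a
   nonempty set even when [A] is empty. *)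
Definition capped_dist (R : realType) (T : pseudoMetricType R) (A : set T) (y : T) : R :=
  inf [set r | r = 1 \/ 0 < r /\ exists2 a, A a & ball y r a].

(** * Metric estimates for the capped distance *)

Section CappedDist.
Context (R : realType) (T : pseudoMetricType R) (A : set T).

Let radii (y : T) := [set r : R | r = 1 \/ 0 < r /\ exists2 a, A a & ball y r a].

Let radii_ge0 y : lbound (radii y) 0.
Proof. by move=> r [->|[/ltW]]. Qed.

Let radii_lb y : has_lbound (radii y).
Proof. by exists 0; exact: radii_ge0. Qed.

Let radii_neq0 y : radii y !=set0.
Proof. by exists 1; left. Qed.

Lemma capped_dist_ge0 y : 0 <= capped_dist A y.
Proof. by apply: lb_le_inf; [exact: radii_neq0 | exact: radii_ge0]. Qed.

Lemma capped_dist_le1 y : capped_dist A y <= 1.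
Proof. by apply: ge_inf; [exact: radii_lb | left]. Qed.

Lemma capped_dist_le y a r : A a -> 0 < r -> ball y r a -> capped_dist A y <= r.
Proof. by move=> Aa r0 yra; apply: ge_inf; [exact: radii_lb | right; split=> //; exists a]. Qed.

Lemma capped_dist_lt y e : capped_dist A y < e -> e <= 1 -> exists2 a, A a & ball y e a.
Proof.
move=> ye e1; have [r + re] := inf_lt (radii_neq0 y) ye.
case=> [r1|[_ [a Aa yra]]]; first by move: re; rewrite r1 ltNge e1.
by exists a => //; apply: le_ball yra; exact: ltW.
Qed.

Lemma capped_dist_gt0 y : nbhs y (~` A) -> 0 < capped_dist A y.
Proof.
move=> /nbhs_ballP[e /= e0 yeA]; rewrite ltNge; apply/negP => y0.
have [|//|a Aa ya] := @capped_dist_lt y (Num.min e 1).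
- by apply: le_lt_trans y0 _; rewrite lt_min e0 ltr01.
- by rewrite ge_min lexx orbT.
- by apply: (yeA a) => //; apply: le_ball ya; rewrite ge_min lexx.
Qed.

Lemma capped_dist_ball y z e : 0 < e -> ball y e z ->
  capped_dist A y <= e + capped_dist A z.
Proof.
move=> e0 yez; rewrite addrC -lerBlDr; apply: lb_le_inf; first exact: radii_neq0.
move=> r.
case=> [->|[r0 [a Aa zra]]]; rewrite lerBlDr.
  by apply: le_trans (capped_dist_le1 y) _; rewrite lerDl ltW.
apply: (@capped_dist_le _ a) => //; first exact: addr_gt0.
by rewrite addrC; exact: ball_triangle yez zra.
Qed.

End CappedDist.

Lemma continuous_ball_lipschitz (R : realType) (T : pseudoMetricType R) (g : T -> R) :
  (forall y z e, 0 < e -> ball y e z -> g y <= e + g z) -> continuous g.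
Proof.
move=> gL y; apply/cvgrPdist_le => e e0.
have : nbhs y (ball y e) by exact: nbhsx_ballx.
apply: filterS => z yez; rewrite ler_norml.
have := gL _ _ _ e0 yez; have := gL _ _ _ e0 (ball_sym yez); lra.
Qed.

Lemma continuous_capped_dist (R : realType) (T : pseudoMetricType R) (A : set T) :
  continuous (capped_dist A).
Proof. by apply: continuous_ball_lipschitz; exact: capped_dist_ball. Qed.

(** * Limits in coordinates and along a subset *)

Lemma cvg_row (R : realType) (T : Type) (F : set_system T) (FF : Filter F) (p : nat)
    (u : 'I_p -> T -> R) (w : 'I_p -> R) :
  (forall j, u j x @[x --> F] --> w j) ->
  (\row_j u j x : 'rV[R]_p) @[x --> F] --> (\row_j w j : 'rV[R]_p).
Proof.
move=> uw; apply/cvg_ballP => e e0.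
have : \forall x \near F, forall j, ball (w j) e (u j x).
  by apply: filter_forall => j; apply: (cvg_ball (uw j)).
by apply: filterS => x xw; split=> // i j; rewrite !mxE; exact: xw.
Qed.

Lemma euclidean_dist_le (R : realType) (p : nat) (v w : 'rV[R]_p) (r : R) :
  0 <= r -> (forall j, `|v ord0 j - w ord0 j| <= r) ->
  euclidean_dist v w <= p%:R * r.
Proof.
move=> r0 vwr; have pr0 : 0 <= p%:R * r by rewrite mulr_ge0.
rewrite /euclidean_dist -[leRHS]ger0_norm// -sqrtr_sqr ler_wsqrtr//.
apply: (@le_trans _ _ (\sum_(i < p) r ^+ 2)).
  apply: ler_sum => j _; rewrite -real_normK ?num_real//.
  by rewrite lerXn2r ?nnegrE.
rewrite sumr_const card_ord -[leLHS]mulr_natl exprMn.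
apply: ler_wpM2r; first exact: sqr_ge0.
by rewrite -natrX ler_nat; case: (p) => // k; rewrite leq_pmulr.
Qed.

Lemma within_open_cvg (S T : topologicalType) (A : set S) (f : S -> T) (x : S) :
  open A -> {within A, continuous f} -> A x -> f @ x --> f x.
Proof.
move=> oA /subspace_continuousP cf Ax P fxP.
have nA : nbhs x A by exact: open_nbhs_nbhs.
have nP : nbhs x (fun y => A y -> P (f y)) := cf x Ax P fxP.
by apply: filterS2 nA nP => y Ay; exact.
Qed.

Lemma cvg_comp_at (T : Type) (F : set_system T) (FF : Filter F) (S U : topologicalType)
    (f : T -> S) (g : S -> U) (y : S) :
  f @ F --> y -> g @ y --> g y -> g (f x) @[x --> F] --> g y.
Proof. by move=> fy gy; apply: cvg_comp fy gy. Qed.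

(** Chart indices will depend on the point but be locally constant on [C], so limits along [C] may
    be computed in one fixed chart. *)
Lemma cvg_locally_constant_index (X T : topologicalType) (I : Type) (C : set X)
    (idx : X -> I) (G : I -> X -> T) (x0 : X) :
  (\forall x \near x0, C x -> idx x = idx x0) ->
  G (idx x0) x @[x --> within C (nbhs x0)] --> G (idx x0) x0 ->
  G (idx x) x @[x --> within C (nbhs x0)] --> G (idx x0) x0.
Proof.
move=> idx0; apply: cvg_trans; apply: near_eq_cvg.
by rewrite /prop_near1/within/=; apply: filterS idx0 => x /[apply] ->.
Qed.

Lemma within_eq_cvg (X T : topologicalType) (C : set X) (f g : X -> T) (x0 : X) :
  (forall x, C x -> f x = g x) -> C x0 ->
  f x @[x --> within C (nbhs x0)] --> f x0 ->
  g x @[x --> within C (nbhs x0)] --> g x0.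
Proof.
move=> fg Cx0; rewrite -fg//; apply: cvg_trans; apply: near_eq_cvg.
by rewrite /prop_near1/within/=; apply: nearW => x /fg.
Qed.

(** * Pushing a map off [Z] over a closed set, in charts *)

Section Step.
Context (R : realType) (X : topologicalType) (n p q : nat) (Y : metricType R)
  (I : Type) (Z : set Y) (U : I -> set Y) (V : I -> set 'rV[R]_p)
  (phi : I -> Y -> 'rV[R]_p) (psi : I -> 'rV[R]_p -> Y).
Hypotheses (nX : normal_space X) (dX : dim_at_most X n) (nq : (n < q)%N) (qp : (q <= p)%N).
Hypotheses (oU : forall i, open (U i)) (oV : forall i, open (V i))
  (hom : forall i, homeomorphism_between (U i) (V i) (phi i) (psi i))
  (lip : forall i, exists k : R, forall v w, V i v -> V i w ->
     mdist (psi i v) (psi i w) <= k * euclidean_dist v w)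
  (codimZ : forall i, phi i @` (U i `&` Z) `<=` ends_with_zeros q).

(* In the charts, [f] is moved by at most [2 * eta] along the last [q] coordinates
   only. There, [f / eta] clamped to the unit cube extends to [K] on all of [X]
   by Tietze's theorem, and adding [(L - K) * eta], where [L] never vanishes and
   agrees with [K] on the boundary of the cube, yields a nonzero vector. *)
Lemma avoid_on_closed (A B C : set X) (idx : X -> I) (f : X -> Y) (delta : X -> R) :
  closed A -> closed B -> closed C -> (forall x, A x -> ~ B x) ->
  (forall x, B x \/ C x) ->
  (forall x, C x -> U (idx x) (f x)) ->
  (forall x0, C x0 -> \forall x \near x0, C x -> idx x = idx x0) ->
  continuous f -> continuous delta -> (forall x, 0 < delta x) ->
  exists g : X -> Y, [/\ continuous g, (forall x, B x -> g x = f x),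
    (forall x, mdist (f x) (g x) < delta x) & (forall x, A x -> ~ Z (g x))].
Proof.
move=> cA cB cC AB BC fU idxC cf cd d0.
have [k kP] := choice lip.
(* The factor [p] converts coordinatewise bounds into Euclidean ones; the summand 1 makes [kappa i]
   positive. *)
pose kappa i := `|k i| * p%:R + 1.
have kappa0 i : 0 < kappa i by rewrite ltr_wpDl// mulr_ge0.
pose h x := phi (idx x) (f x).
pose rho i x := capped_dist (~` V i) (phi i (f x)).
(* For [x] in [C], a coordinate displacement of at most [2 * eta x] stays in the chart image, as
   [4 * eta x <= rho (idx x) x], and moves the point of [Y] by at most [delta x / 2]. *)
pose eta x := Num.min (delta x / kappa (idx x)) (rho (idx x) x) / 4.
have phiU i y : U i y -> V i (phi i y) by move=> Uy; have [+ _ _ _ _] := hom i; apply.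
have psiV i v : V i v -> U i (psi i v) by move=> Vv; have [_ + _ _ _] := hom i; apply.
have phiK i y : U i y -> psi i (phi i y) = y by have [_ _ + _ _] := hom i; apply.
have psiK i v : V i v -> phi i (psi i v) = v by have [_ _ _ + _] := hom i; apply.
have cphi i y : U i y -> phi i @ y --> phi i y.
  by apply: within_open_cvg => //; have [_ _ _ _ []] := hom i.
have cpsi i v : V i v -> psi i @ v --> psi i v.
  by apply: within_open_cvg => //; have [_ _ _ _ []] := hom i.
have hV x : C x -> V (idx x) (h x) by move=> /fU /phiU.
have phif x0 : C x0 -> phi (idx x0) (f x) @[x --> within C (nbhs x0)] --> h x0.
  move=> Cx0; apply: cvg_comp_at; last exact/cphi/fU.
  by apply: cvg_within_filter; exact: cf.
have ch x0 : C x0 -> h x @[x --> within C (nbhs x0)] --> h x0.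
  move=> Cx0; apply: (@cvg_locally_constant_index _ _ _ _ _ (fun i x => phi i (f x))).
    exact: idxC.
  exact: phif.
have eta0 x : C x -> 0 < eta x.
  move=> Cx; rewrite divr_gt0// lt_min divr_gt0//= capped_dist_gt0// setCK.
  by apply: open_nbhs_nbhs; split; [exact: oV | exact: hV].
have ceta x0 : C x0 -> eta x @[x --> within C (nbhs x0)] --> eta x0.
  move=> Cx0; apply: (@cvg_locally_constant_index _ _ _ _ _
    (fun i x => Num.min (delta x / kappa i) (rho i x) / 4)); first exact: idxC.
  apply: cvgMl; apply: cvg_minr.
    by apply: cvgMl; apply: cvg_within_filter; exact: cd.
  by apply: cvg_comp_at; [exact: phif | exact: continuous_capped_dist].
have chj j x0 : C x0 -> h x ord0 j @[x --> within C (nbhs x0)] --> h x0 ord0 j.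
  move=> Cx0; apply: (@cvg_comp_at _ _ _ _ _ h (fun M => M ord0 j) _ (ch x0 Cx0)).
  exact: coord_continuous.
pose H j x := clamp (h x ord0 j / eta x).
have cH j : {within C, continuous (H j)}.
  apply/subspace_continuousP => x0 Cx0; apply: cvg_clamp; apply: cvgM.
    exact: chj.
  by apply: cvgV; [rewrite gt_eqF ?eta0 | exact: ceta].
have /choice[K KP] : forall j, exists g : X -> R, [/\ {in C, H j =1 g},
    continuous g & forall x, -1 <= g x <= 1].
  move=> j; have H1 x : C x -> `|(H j x : R^o)| <= 1.
    by move=> _; rewrite -[`|_|]/(`|(H j x : R)|) ler_norml clamp_itv.
  have [g [gH cg g1]] := continuous_bounded_extension nX cC ltr01 (cH j) H1.
  exists g; split=> // x; have : `|(g x : R)| <= 1 := g1 x.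
  by rewrite ler_norml.
have KH j x : C x -> K j x = H j x.
  by move=> Cx; have [HK _ _] := KP j; rewrite HK// inE.
pose P := finset (fun j : 'I_p => (p - q <= j)%N).
have nP : (n < #|P|)%N.
  have lt_p (i : 'I_q) : (p - q + i < p)%N by rewrite -{2}(subnK qp) ltn_add2l.
  apply: (leq_trans nq); rewrite -[leqLHS]card_ord -cardsT.
  rewrite -(@card_imset _ _ (fun i => Ordinal (lt_p i))).
    by apply/subset_leq_card/fintype.subsetP => _ /imsetP[i _ ->]; rewrite inE leq_addr.
  by move=> i j /(congr1 val)/addnI/val_inj.
have [|L [cL L1 LK L0]] := @avoid_zero_rel R X n p P K nX dX nP.
  by move=> j; have [] := KP j.
have [chi [cchi chi01 chiB chiA]] : exists chi : X -> R, [/\ continuous chi,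
    (forall x, 0 <= chi x <= 1),
    (forall x, B x -> chi x = 0) & (forall x, A x -> chi x = 1)].
  by apply: urysohn_function => // x Bx Ax; exact: AB Bx.
pose t j x := chi x * (L j x - K j x) * (j \in P)%:R * eta x.
pose v x : 'rV[R]_p := \row_j (h x ord0 j + t j x).
have t_le j x : C x -> `|t j x| <= 2 * eta x.
  move=> Cx; rewrite /t 2!normrM (ger0_norm (ltW (eta0 x Cx))).
  rewrite ler_pM2r ?eta0// -[2]mulr1; apply: ler_pM => //; last first.
    by case: (j \in P); rewrite ?normr0 ?normr1.
  rewrite normrM -[2]mul1r; have [_ _ /(_ x)/andP[k0 k1]] := KP j.
  have /andP[l0 l1] := L1 j x; have /andP[c0 c1] := chi01 x.
  apply: ler_pM => //; first by rewrite ger0_norm.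
  by rewrite ler_norml; lra.
have vh x j : v x ord0 j - h x ord0 j = t j x by rewrite mxE addrC addKr.
have vV x : C x -> V (idx x) (v x).
  move=> Cx; apply: contrapT => nV; have := eta0 x Cx => e0.
  have : capped_dist (~` V (idx x)) (h x) <= 3 * eta x.
    apply: (@capped_dist_le _ _ _ _ (v x)) => //; first by rewrite mulr_gt0.
    split; first by rewrite mulr_gt0.
    move=> i j; rewrite ord1 /ball/= distrC vh; apply: le_lt_trans (t_le j x Cx) _.
    by rewrite ltr_pM2r// ltr_nat.
  rewrite -/(rho (idx x) x).
  have : 4 * eta x <= rho (idx x) x by rewrite /eta mulrC divfK// ge_min lexx orbT.
  lra.
have cv x0 : C x0 -> v x @[x --> within C (nbhs x0)] --> v x0.
  move=> Cx0; apply: (@cvg_row _ _ _ _ _ (fun j x => h x ord0 j + t j x)) => j.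
  apply: cvgD; first exact: chj.
  apply: cvgM; last exact: ceta.
  apply: cvgMl; apply: cvg_within_filter; apply: cvgM; first exact: cchi.
  by apply: cvgB; [exact: cL | have [_ + _] := KP j; apply].
(* Both formulas agree on the overlap of the closed sets [B] and [C], since [chi] vanishes on [B];
   hence [g] is continuous. *)
pose g x := if pselect (C x) then psi (idx x) (v x) else f x.
have gC x : C x -> g x = psi (idx x) (v x) by rewrite /g; case: pselect.
have gB x : B x -> g x = f x.
  move=> Bx; rewrite /g; case: pselect => // Cx.
  suff -> : v x = h x by exact/phiK/fU.
  by apply/rowP => j; rewrite mxE /t chiB// !mul0r addr0.
exists g; split => //.
- have BCT : B `|` C = setT by rewrite -subTset => x _; exact: BC.
  have cg : {within B `|` C, continuous g}.
    apply: withinU_continuous => //.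
      apply/subspace_continuousP => x0 Bx0; apply: (within_eq_cvg (f := f)) => //.
        by move=> x /gB.
      by apply: cvg_within_filter; exact: cf.
    apply/subspace_continuousP => x0 Cx0.
    apply: (within_eq_cvg (f := fun x => psi (idx x) (v x))) => //; first by move=> x /gC.
    apply: (@cvg_locally_constant_index _ _ _ _ _ (fun i x => psi i (v x))).
      exact: idxC.
    by apply: cvg_comp_at; [exact: cv | exact/cpsi/vV].
  by move=> x; apply: (@within_open_cvg _ _ setT) => //; [exact: openT | rewrite -BCT].
- move=> x; have [Bx|Cx] := BC x; first by rewrite gB// mdistxx.
  rewrite gC// -[f x](phiK (idx x) (f x) (fU x Cx)).
  apply: le_lt_trans (kP (idx x) _ _ (hV x Cx) (vV x Cx)) _.
  have := eta0 x Cx => e0.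
  have : euclidean_dist (h x) (v x) <= p%:R * (2 * eta x).
    apply: euclidean_dist_le; first by rewrite mulr_ge0// ltW.
    by move=> j; rewrite distrC vh t_le.
  have : kappa (idx x) * eta x <= delta x / 4.
    rewrite /eta mulrA ler_pM2r ?invr_gt0// mulrC -ler_pdivlMr//.
    by rewrite ge_min lexx.
  have ek : k (idx x) * euclidean_dist (h x) (v x) <=
      `|k (idx x)| * euclidean_dist (h x) (v x).
    by apply: ler_wpM2r; [exact: sqrtr_ge0 | exact: ler_norm].
  rewrite /kappa mulrDl mul1r => ke /(ler_wpM2l (normr_ge0 (k (idx x)))) eu.
  apply: le_lt_trans ek _; apply: le_lt_trans eu _.
  rewrite -[X in X < _]mulrCA [p%:R * _]mulrCA.
  have := d0 x; lra.
- move=> x Ax.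
  have Cx : C x by have [Bx|//] := BC x; have := AB x Ax Bx.
  rewrite gC// => Zg.
  have [_ v0] : ends_with_zeros q (v x).
    apply: (codimZ (i := idx x)); exists (psi (idx x) (v x)); last by apply/psiK/vV.
    by split=> //; apply/psiV/vV.
  have {}v0 j : j \in P -> h x ord0 j + (L j x - K j x) * eta x = 0.
    move=> jP; have := v0 j; rewrite mxE /t jP chiA// mul1r mulr1; apply.
    by rewrite inE in jP.
  have := eta0 x Cx => e0.
  (* The clamping is inactive: if the quotient were at least 1 or at most -1, then [L j x = K j x],
     and [v0] would make it 0. Now [v0] reads [L j x * eta x = 0] for all [j] in [P], against
     [L0]. *)
  have hK j : j \in P -> K j x = h x ord0 j / eta x.
    move=> jP; rewrite KH// /H; case: (clampP (h x ord0 j / eta x)) => -[a aE] //.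
      have /LK LKj : K j x = 1 \/ K j x = -1 by right; rewrite KH.
      by move: (v0 j jP); rewrite LKj subrr mul0r addr0 => hj; move: a; rewrite hj mul0r; lra.
    have /LK LKj : K j x = 1 \/ K j x = -1 by left; rewrite KH.
    by move: (v0 j jP); rewrite LKj subrr mul0r addr0 => hj; move: a; rewrite hj mul0r; lra.
  have [j jP] := L0 x; apply/negP; rewrite negbK.
  have he : h x ord0 j / eta x * eta x = h x ord0 j by rewrite divfK ?gt_eqF.
  have /eqP := v0 j jP; rewrite hK// mulrBl he addrCA subrr addr0.
  by rewrite mulf_eq0 (gt_eqF e0) orbF.
Qed.
End Step.

(** * Gluing countably many stages *)

Lemma closed_superlevel (R : realType) (X : topologicalType) (g : X -> R) (c : R) :
  continuous g -> closed [set x | c <= g x].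
Proof.
move=> cg; apply: (@preimage_closed _ _ g [set r | c <= r]) => [x _|]; first exact: cg.
exact: closed_ge.
Qed.

Lemma closed_sublevel (R : realType) (X : topologicalType) (g : X -> R) (c : R) :
  continuous g -> closed [set x | g x <= c].
Proof.
move=> cg; apply: (@preimage_closed _ _ g [set r | r <= c]) => [x _|]; first exact: cg.
exact: closed_le.
Qed.

(** The value at [m] involves only indices below [m], that is, earlier stages. *)
Fixpoint running_max (R : realType) (g : nat -> R) (m : nat) : R :=
  if m is m'.+1 then Num.max (running_max g m') (g m') else 0.

Lemma running_max_ge (R : realType) (g : nat -> R) (i m : nat) :
  (i < m)%N -> g i <= running_max g m.
Proof.
elim: m => // m IH; rewrite ltnS leq_eqVlt /= le_max => /orP[/eqP ->|/IH ->//].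
by rewrite lexx orbT.
Qed.

Lemma running_max_homo (R : realType) (g : nat -> R) (i m : nat) :
  (i <= m)%N -> running_max g i <= running_max g m.
Proof.
move=> /subnK <-; elim: (m - i)%N => [|k IH]; first by rewrite add0n.
by rewrite addSn /= le_max IH.
Qed.

Lemma continuous_running_max (R : realType) (X : topologicalType) (g : nat -> X -> R) m :
  (forall i, continuous (g i)) -> continuous (fun x => running_max (g^~ x) m).
Proof.
move=> cg; elim: m => [|m IH] x /=; first exact: cvg_cst.
by apply: cvg_maxr; [exact: IH | exact: cg].
Qed.

Section Globalization.
Context (R : realType) (X : topologicalType) (Y : metricType R) (Z : set Y)
  (f : X -> Y) (eps : X -> R) (gamma : nat -> X -> R).
Hypotheses (nX : normal_space X) (cZ : closed Z) (cf : continuous f)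
  (ceps : continuous eps) (eps0 : forall x, 0 < eps x)
  (cgamma : forall m, continuous (gamma m))
  (gamma_cover : forall x, exists m, gamma m x = 1).

Let M m x := running_max (gamma^~ x) m.

(* [M m] is large where a previous stage has already dealt with [Z]: stage [m] may
   modify the map only where [gamma m > 0] and [M m < 3 / 4]. *)
Hypothesis step : forall m (f' : X -> Y) (delta : X -> R) (A B : set X),
  closed A -> closed B -> (forall x, A x -> ~ B x) ->
  (forall x, ~ B x -> 0 < gamma m x /\ M m x < 3 / 4) ->
  continuous f' -> (forall x, mdist (f x) (f' x) < eps x) ->
  continuous delta -> (forall x, 0 < delta x) ->
  exists g : X -> Y, [/\ continuous g, (forall x, B x -> g x = f' x),
    (forall x, mdist (f' x) (g x) < delta x) & (forall x, A x -> ~ Z (g x))].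

(** The factor of [eps x] is the sum of [2^-(i+1)] over [i < m], hence below 1. Avoidance holds from
    level [1/2] on, while maps are frozen only from [3/4] on; this gap keeps [A] and [B] below
    disjoint. *)
Let good m (f' : X -> Y) := [/\ continuous f',
  (forall x, mdist (f x) (f' x) <= (1 - 2^-1 ^+ m) * eps x) &
  (forall x, 2^-1 <= M m x -> ~ Z (f' x))].

Let cM m : continuous (M m).
Proof. exact: continuous_running_max. Qed.

(** A point with [2^-1 <= M m.+1 x] either satisfies [2^-1 <= M m x], where the perturbation is too
    small to reach [Z], or lies in [A], where [step] pushes the map off [Z]. *)
Lemma avoid_stage m (f' : X -> Y) : good m f' ->
  exists2 f'' : X -> Y, good m.+1 f'' & forall x, 3 / 4 <= M m x -> f'' x = f' x.
Proof.
move=> [cf' f'f f'Z].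
have half_gt0 k : (0 : R) < 2^-1 ^+ k by rewrite exprn_gt0// invr_gt0.
have cZf' : closed (f' @^-1` Z).
  by apply: preimage_closed => // x _; exact: cf'.
have [u [cu u01 u0 u1]] : exists u : X -> R, [/\ continuous u, (forall x, 0 <= u x <= 1),
    (forall x, 2^-1 <= M m x -> u x = 0) & (forall x, (f' @^-1` Z) x -> u x = 1)].
  by apply: (@urysohn_function R X [set x | 2^-1 <= M m x]) => //; exact: closed_superlevel.
have dist0 x : ~ Z (f' x) -> 0 < capped_dist Z (f' x).
  move=> nZ; apply: capped_dist_gt0; apply: open_nbhs_nbhs; split=> //.
  by rewrite openC.
(* The first term is the budget of stage [m]. Where [2^-1 <= M m x], the second is half the capped
   distance to [Z]; where [f' x] is in [Z] and this distance is 0, [u] keeps it positive. *)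
pose delta x := Num.min (2^-1 ^+ m.+1 * eps x) ((capped_dist Z (f' x) + u x) / 2).
pose A := [set x | 2^-1 <= gamma m x] `&` [set x | M m x <= 2^-1].
pose B := [set x | gamma m x <= 0] `|` [set x | 3 / 4 <= M m x].
have [||||||||g [cg gB gd gA]] := @step m f' delta A B.
- by apply: closedI; [exact: closed_superlevel | exact: closed_sublevel].
- by apply: closedU; [exact: closed_sublevel | exact: closed_superlevel].
- move=> x [/= a1 a2] Bx; suff : (0 : R) < 0 by rewrite ltxx.
  by case: Bx => /=; lra.
- move=> x nB; split; rewrite ltNge; apply/negP => h; apply: nB; [by left | by right].
- exact: cf'.
- by move=> x; apply: le_lt_trans (f'f x) _; rewrite -[ltRHS]mul1r ltr_pM2r// gtrBl.
- move=> x; apply: cvg_minr; first by apply: cvgMr; exact: ceps.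
  apply: cvgMl; apply: cvgD; last exact: cu.
  by apply: cvg_comp_at; [exact: cf' | exact: continuous_capped_dist].
- move=> x; rewrite lt_min mulr_gt0//= divr_gt0//.
  case: (pselect (Z (f' x))) => [/u1 ->|/dist0 d0].
    by rewrite ltr_wpDl// capped_dist_ge0.
  by rewrite ltr_wpDr//; case/andP: (u01 x).
exists g; last by move=> x Mx; apply: gB; right.
split=> // [x|x].
- apply: le_trans (metric_triangle (f x) (f' x) (g x)) _.
  have : mdist (f' x) (g x) <= 2^-1 ^+ m.+1 * eps x.
    by apply: ltW; apply: lt_le_trans (gd x) _; rewrite ge_min lexx.
  have := f'f x; rewrite exprS; have := eps0 x; lra.
- rewrite /M /= le_max -/(M m x) => /orP Mg Zg.
  have [Mx|Mx] := leP 2^-1 (M m x).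
    have cap0 := dist0 x (f'Z x Mx).
    have : capped_dist Z (f' x) <= delta x.
      apply: (capped_dist_le Zg); last by rewrite ballEmdist; exact: gd.
      exact: le_lt_trans (mdist_ge0 _ _) (gd x).
    have : delta x <= capped_dist Z (f' x) / 2.
      by rewrite ge_min (u0 x Mx) addr0 lexx orbT.
    by lra.
  case: Mg => [|gx]; first by rewrite leNgt Mx.
  by apply: (gA x) => //; split=> //=; exact: ltW.
Qed.

(* Near [x], the sequence of maps is constant from stage [N x + 1] on, hence no
   completeness of [Y] is needed for the limit. *)
Lemma avoid_global : exists2 g : X -> Y, continuous g &
  forall x, ~ Z (g x) /\ mdist (f x) (g x) < eps x.
Proof.
(* [F] is made total for the recursion: pairs that are not [good] get the default [f]. *)
have /choice[F FP] : forall mf : nat * (X -> Y), exists f'', good mf.1 mf.2 ->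
    good mf.1.+1 f'' /\ forall x, 3 / 4 <= M mf.1 x -> f'' x = mf.2 x.
  move=> [m f'] /=; case: (pselect (good m f')) => [/avoid_stage[f'' g1 g2]|ng].
    by exists f''.
  by exists f.
pose fix fs m := if m is m'.+1 then F (m', fs m') else f.
have fsP m : good m (fs m).
  elim: m => [|m IH]; last by have [] := FP (m, fs m) IH.
  split=> // x /=; first by rewrite mdistxx expr0 subrr mul0r.
  by rewrite /M/=; lra.
have fsE m x : 3 / 4 <= M m x -> fs m.+1 x = fs m x.
  by move=> Mx; have [_] := FP (m, fs m) (fsP m); apply.
have fsS a b x : 3 / 4 <= M a x -> (a <= b)%N -> fs b x = fs a x.
  move=> Mx /subnK <-; elim: (b - a)%N => // k IH; rewrite addSn fsE//.
  by apply: le_trans Mx _; apply: running_max_homo; exact: leq_addl.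
have [N NP] := choice gamma_cover.
have MN x : 1 <= M (N x).+1 x by rewrite -(NP x) running_max_ge.
exists (fun x => fs (N x).+1 x) => x.
  have [cfs _ _] := fsP (N x).+1.
  apply: cvg_trans (cfs x); apply: near_eq_cvg.
  have : nbhs x (M (N x).+1 @^-1` [set r | 3 / 4 < r]).
    apply: open_nbhs_nbhs; split; last by have := MN x; rewrite /=; lra.
    by apply: open_comp => [y _|]; [exact: cM | exact: open_gt].
  apply: filterS => y My0; have My' := MN y.
  have /ltW My : 3 / 4 < M (N x).+1 y by exact: My0.
  suff -> : fs (N x).+1 y = fs (N y).+1 y by [].
  have [le|/ltnW le] := leqP (N y) (N x).
    by apply: (fsS (N y).+1 (N x).+1) => //; lra.
  by rewrite (fsS (N x).+1 (N y).+1).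
have [_ fsd fsZ] := fsP (N x).+1; split.
  by apply: fsZ; have := MN x; lra.
by apply: le_lt_trans (fsd x) _; rewrite -[ltRHS]mul1r ltr_pM2r// gtrBl.
Qed.
End Globalization.

(** * The closure of [Z] and Stone's cover of [Y] *)

(** A nonzero coordinate of [phi y] would remain nonzero near [y], hence at some point of [Z] in
    [U]. Such a point also provides [q <= p]. *)
Lemma closure_codim (R : realType) (p q : nat) (Y : metricType R) (Z U : set Y)
    (V : set 'rV[R]_p) (phi : Y -> 'rV[R]_p) (psi : 'rV[R]_p -> Y) :
  open U -> homeomorphism_between U V phi psi ->
  phi @` (U `&` Z) `<=` ends_with_zeros q ->
  phi @` (U `&` closure Z) `<=` ends_with_zeros q.
Proof.
move=> oU [_ _ _ _ [cphi _]] phiZ _ [y [Uy Zy] <-].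
have nU : nbhs y U by exact: open_nbhs_nbhs.
split=> [|j qj].
  have [z [Zz Uz]] := Zy _ nU.
  by have [] : ends_with_zeros q (phi z) by apply: phiZ; exists z.
apply: contrapT => phi_neq0.
have cj : phi z ord0 j @[z --> y] --> phi y ord0 j.
  apply: (@cvg_comp_at _ _ _ _ _ phi (fun v => v ord0 j)).
    exact: within_open_cvg cphi Uy.
  exact: coord_continuous.
have nphi : nbhs y [set z | phi z ord0 j <> 0].
  apply: (cj (~` [set 0])); apply: open_nbhs_nbhs; split=> //.
  by rewrite openC; exact: closed_eq.
have [z [Zz [Uz /= phiz]]] := Zy _ (filterI nU nphi).
apply: phiz; have [_] : ends_with_zeros q (phi z) by apply: phiZ; exists z.
exact.
Qed.

(* Stone's construction: [T m i] consists of the points at depth [2^-m] in [U i]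
   for which [i] is the first index of a chart domain containing them. *)
Lemma stone_separated_cover (R : realType) (Y : metricType R) (I : Type)
    (U : I -> set Y) :
  open_covering U ->
  exists T : nat -> I -> set Y,
  [/\ (forall m i y z, T m i y -> mdist y z < 2^-1 ^+ m -> U i z),
      (forall m i j y z, T m i y -> T m j z -> mdist y z < 2^-1 ^+ m -> i = j) &
      (forall y, exists m i, T m i y)].
Proof.
move=> [oU cU].
have [le wo] := wochoice.well_ordering_principle {classic I}.
(* Antisymmetry is the uniqueness of the least element of the pair [i], [j]. *)
have le_anti i j : le i i -> le i j -> le j i -> le j j -> i = j.
  move=> ii ij ji jj.
  have [|k [_ kP]] := wo [pred k | (k == i) || (k == j)]; first by exists i; rewrite inE eqxx.
  rewrite -(kP i) ?(kP j)//; split; rewrite ?inE ?eqxx ?orbT// => l;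
    by rewrite inE => /orP[] /eqP ->.
exists (fun m i => [set y | (forall z, mdist y z < 2^-1 ^+ m -> U i z) /\
  forall j, U j y -> le i j]); split.
- by move=> m i y z [yU _]; exact: yU.
- move=> m i j y z [yU yi] [zU zj] yz; have m0 : (0 : R) < 2^-1 ^+ m by rewrite exprn_gt0// invr_gt0.
  have Uiy : U i y by apply: yU; rewrite mdistxx.
  have Uiz := yU _ yz.
  have Ujz : U j z by apply: zU; rewrite mdistxx.
  have Ujy : U j y by apply: zU; rewrite metric_sym.
  by apply: (le_anti i j); [exact: yi | exact: yi | exact: zj | exact: zj].
- move=> y; have [i0 _ Ui0] : (\bigcup_i U i) y by rewrite cU.
  have [|i [[iU ile] _]] := wo [pred i : {classic I} | `[<U i y>]].
    by exists i0; exact/asboolP.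
  have {iU}Ui : U i y by exact/asboolP.
  have /nbhs_ballP[e /= e0 ye] : nbhs y (U i) by apply: open_nbhs_nbhs; split.
  have [m me] : exists m, 2^-1 ^+ m < e :> R.
    exists (Num.bound e^-1); rewrite exprVn invf_plt ?posrE ?exprn_gt0//.
    apply: lt_trans (archi_boundP (ltW _)) _; first by rewrite invr_gt0.
    by rewrite -natrX ltr_nat ltn_expl.
  exists m, i; split=> [z yz|j Uj].
    by apply: ye; rewrite ballEmdist /=; exact: lt_trans yz me.
  by apply: ile; exact/asboolP.
Qed.

(** * Choice of scales and conclusion *)

Lemma capped_dist_eq0 (R : realType) (T : pseudoMetricType R) (A : set T) (y : T) :
  A y -> capped_dist A y = 0.
Proof.
move=> Ay; apply/eqP; rewrite eq_le capped_dist_ge0 andbT.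
apply/ler_addgt0Pl => e e0; rewrite addr0.
by apply: (capped_dist_le Ay) => //; exact: ballxx.
Qed.

Theorem theorem3p4 (R : realType) (n q : nat) (hqn : (n < q)%N)
    (X : topologicalType) (hXnormal : normal_space X) (hXdim : has_dimension X n)
    (p : nat) (Y : metricType R) (hY : is_manifold R p Y)
    (Z : set Y) (hZ : lipschitz_codim_at_least p q Z) :
  avoidable X Z.
Proof.
move=> f eps cf ceps eps0.
(* A point of [Z] yields [q <= p] and a default index [i0]; for empty [Z] the map [f] itself
   works. *)
have [[z0 Zz0]|Z0] := pselect (Z !=set0); last first.
  by exists f => // x; rewrite mdistxx; split=> // Zx; apply: Z0; exists (f x).
have [I [U [V [phi [psi [covU charts]]]]]] := hZ.
have [oU cU] := covU.
have oV i : open (V i) by have [] := charts i.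
have hom i : homeomorphism_between (U i) (V i) (phi i) (psi i) by have [] := charts i.
have lip i : exists k : R, forall v w, V i v -> V i w ->
    mdist (psi i v) (psi i w) <= k * euclidean_dist v w by have [] := charts i.
have codimZ i : phi i @` (U i `&` closure Z) `<=` ends_with_zeros q.
  by apply: closure_codim (oU i) (hom i) _; have [] := charts i.
have [i0 _ Ui0] : (\bigcup_i U i) z0 by rewrite cU.
have qp : (q <= p)%N.
  have [] // : ends_with_zeros q (phi i0 z0).
  by apply: codimZ; exists z0 => //; split=> //; exact: subset_closure.
have [T [TU Tsep Tcover]] := stone_separated_cover covU.
(* The separation [8 * r m] leaves room for two distances below [2 * r m] to the pieces and a
   variation of [f] below [r m]. *)
pose r m : R := 2^-1 ^+ m / 8.
have r0 m : 0 < r m by rewrite divr_gt0// exprn_gt0// invr_gt0.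
have rS m : 2^-1 ^+ m = 8 * r m by rewrite mulrC divfK.
have r_le k m : (m <= k)%N -> r k <= r m.
  by move=> mk; rewrite ler_pM2r// ler_wiXn2l//; lra.
have r_le1 m : 2 * r m <= 1 by have := r_le m 0 (leq0n m); rewrite /r expr0; lra.
pose d m := capped_dist (\bigcup_i T m i).
(* [sigma (f x)] bounds the admissible perturbation by the scale of the first stage
   at which [x] is dealt with. *)
pose gaps y := [set v | exists m, v = r m / 4 - d m y].
pose sigma y := sup (gaps y).
have gaps_neq0 y : gaps y !=set0 by exists (r 0 / 4 - d 0 y); exists 0%N.
have gaps_ub y : has_ubound (gaps y).
  exists 1 => _ [m ->]; have := capped_dist_ge0 (\bigcup_i T m i) y.
  by rewrite -/(d m y); have := r_le1 m; have := r0 m; lra.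
have sigma_ge m y : r m / 4 - d m y <= sigma y.
  by apply: (ub_le_sup (gaps_ub y)); exists m.
have sigma_le m y : (forall i, (i < m)%N -> r i / 4 <= d i y) -> sigma y <= r m / 4.
  move=> di; apply: ge_sup => // _ [k ->].
  have [km|mk] := ltnP k m; first by have := di k km; have := r0 m; lra.
  have := capped_dist_ge0 (\bigcup_i T k i) y; rewrite -/(d k y).
  by have := r_le _ _ mk; lra.
have dT y : exists m, d m y = 0.
  have [m [i Ty]] := Tcover y; exists m.
  by apply: capped_dist_eq0; exists i.
have sigma0 y : 0 < sigma y.
  have [m dm] := dT y; have := sigma_ge m y; have := r0 m; rewrite dm; lra.
have csigma : continuous sigma.
  apply: continuous_ball_lipschitz => y z e e0 yz; apply: ge_sup => // _ [m ->].
  have := @capped_dist_ball _ _ (\bigcup_i T m i) _ _ _ e0 (ball_sym yz).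
  by rewrite -!/(d m _); have := sigma_ge m z; lra.
pose gamma m x := 1 - d m (f x) / r m.
have cgamma m : continuous (gamma m).
  move=> x; apply: cvgB; first exact: cvg_cst.
  apply: cvgMl; apply: cvg_comp_at; [exact: cf | exact: continuous_capped_dist].
pose eps' x := Num.min (eps x) (sigma (f x)).
have [||||g cg gP] := @avoid_global R X Y (closure Z) f eps' gamma hXnormal
  (@closed_closure _ Z) cf _ _ cgamma.
- by move=> x; apply: cvg_minr; [exact: ceps | apply: cvg_comp_at; [exact: cf | exact: csigma]].
- by move=> x; rewrite lt_min eps0 sigma0.
- by move=> x; have [m dm] := dT (f x); exists m; rewrite /gamma dm mul0r subr0.
- move=> m f' delta A B cA cB AB BP cf' f'f cdelta delta0.
  (* [C] contains the complement of [B]. On it each earlier [gamma i] is at most [3/4], so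
     [r i / 4 <= d i (f x)], whence [sigma (f x) <= r m / 4]. *)
  pose C := [set x | 0 <= gamma m x] `&` [set x | running_max (gamma^~ x) m <= 3 / 4].
  have cC : closed C.
    apply: closedI; first exact: closed_superlevel.
    exact/closed_sublevel/continuous_running_max.
  have CP x : C x -> d m (f x) <= r m /\ sigma (f x) <= r m / 4.
    move=> [/= g0 gm]; split.
      by move: g0; rewrite /gamma subr_ge0 ler_pdivrMr// mul1r.
    apply: sigma_le => i im; have := le_trans (running_max_ge (gamma^~ x) im) gm.
    rewrite /gamma lerBlDr -lerBlDl => h.
    have : (1 - 3 / 4) * r i <= d i (f x) by rewrite -ler_pdivlMr.
    lra.
  (* The bound is [2 * r m] and not [r m] because the infimum need not be attained. Separation of
     the family makes [idx] locally constant on [C]. *)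
  have /choice[idx idxP] : forall x, exists i, C x ->
      exists2 z, T m i z & mdist (f x) z < 2 * r m.
    move=> x; case: (pselect (C x)) => [/CP[dx _]|nC]; last by exists i0.
    have [||z [i _ Tz] fz] := @capped_dist_lt R Y (\bigcup_i T m i) (f x) (2 * r m) => //.
      by rewrite -/(d m (f x)); have := r0 m; lra.
    by exists i => _; exists z => //; move: fz; rewrite ballEmdist.
  apply: (@avoid_on_closed R X n p q Y I (closure Z) U V phi psi hXnormal _ hqn qp
    oU oV hom lip codimZ A B C idx f' delta) => //.
  + by case: hXdim.
  + move=> x; case: (pselect (B x)) => [|/BP[g0 gm]]; [by left|right; split; exact: ltW].
  + move=> x Cx; have [z Tz fz] := idxP x Cx.
    apply: (TU m (idx x) z _ Tz).
    have := metric_triangle z (f x) (f' x); rewrite (metric_sym z (f x)) rS.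
    have : mdist (f x) (f' x) < sigma (f x).
      by apply: lt_le_trans (f'f x) _; rewrite ge_min lexx orbT.
    by have [_ +] := CP x Cx; have := r0 m; lra.
  + move=> x0 Cx0; have [z Tz fz] := idxP x0 Cx0.
    have : nbhs x0 (f @^-1` (ball (f x0) (r m))).
      by apply: cf; exact: nbhsx_ballx.
    apply: filterS => x; rewrite ballEmdist /= => fx Cx.
    have [z' Tz' fz'] := idxP x Cx.
    apply/esym; apply: (Tsep m _ _ z z') => //.
    have := metric_triangle z (f x0) z'; have := metric_triangle (f x0) (f x) z'.
    by rewrite (metric_sym z (f x0)) rS; have := r0 m; lra.
exists g => // x; have [nZ dx] := gP x; split.
  by move=> Zx; apply: nZ; exact: subset_closure.
by apply: lt_le_trans dx _; rewrite ge_min lexx.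
Qed.
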